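(* Let $\Theta=\mathcal{A}\times\Gamma\times\mathcal{S}\subset\mathbb{R}^{p+2}$ with $\mathcal{A}\subset\mathbb{R}$, $\Gamma\subset\mathbb{R}^p$, $\mathcal{S}\subset(0,\infty)$, and let $\boldsymbol{\theta}=(\alpha,\boldsymbol{\gamma},\sigma)\in\Theta$. Let $\psi(\cdot;\boldsymbol{\gamma}):\mathbb{R}\to\mathbb{R}$ be measurable and suppose that the function $y\mapsto\psi(y;\boldsymbol{\gamma})\,y$ is bounded on $\mathbb{R}$. Then the SDAR model, i.e. the Markov chain $$Y_t=\alpha+\psi(Y_{t-1};\boldsymbol{\gamma})\,Y_{t-1}+\xi_t,\qquad t\ge 1,$$ with $(\xi_t)_{t\ge1}$ i.i.d. normal with mean $0$ and standard deviation $\sigma$, is uniformly ergodic.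
   Context: SDAR stands for state-dependent first-order autoregressive process; $\psi$ is called the persistence function and depends on a $p$-dimensional parameter vector $\boldsymbol{\gamma}$; the errors $\xi_t$ are i.i.d. Gaussian with mean zero and volatility (standard deviation) $\sigma>0$. In the paper the chain is started at $Y_0=0$; uniform ergodicity is a property of its transition kernel $P(y,\cdot)$, which is the normal law with mean $\alpha+\psi(y;\boldsymbol{\gamma})y$ and standard deviation $\sigma$. The chain is uniformly ergodic if there exist an invariant probability measure $\pi$ of $P$ and constants $C<\infty$, $\rho\in[0,1)$ such that $\sup_{y\in\mathbb{R}}\|P^n(y,\cdot)-\pi\|_{TV}\le C\rho^n$ for all $n\ge 1$. *)

(* Defs.v *)
From HB Require Import structures.
From mathcomp Require Import all_boot all_order all_algebra.
From mathcomp Require Import all_classical all_reals all_analysis.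
From mathcomp Require Import measurable_realfun.

Set Implicit Arguments.
Unset Strict Implicit.
Unset Printing Implicit Defensive.

Import Order.TTheory GRing.Theory Num.Theory.
Import numFieldNormedType.Exports.

Local Open Scope classical_set_scope.
Local Open Scope ring_scope.

Section uniform_ergodicity.
Context d (T : measurableType d) (R : realType).
Local Open Scope ereal_scope.

(* For probability measures this is half the variation norm of mu - nu; the
   factor 2 separating the two usual normalizations is immaterial in
   uniformly_ergodic, where it can be absorbed in the constant C. *)
Definition tv_dist (mu nu : {measure set T -> \bar R}) : \bar R :=
  ereal_sup [set `|mu A - nu A| | A in [set A : set T | measurable A]].

Fixpoint kiter (P : R.-pker T ~> T) (n : nat) : R.-spker T ~> T :=
  if n is m.+1 then mkcomp_noparam (kiter P m) P
  else kdirac (@measurable_id _ T [set: T]).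

Definition invariant_prob (P : R.-pker T ~> T) (pi : probability T R) : Prop :=
  forall A : set T, measurable A -> \int[pi]_y P y A = pi A.

Definition uniformly_ergodic (P : R.-pker T ~> T) : Prop :=
  exists pi : probability T R, invariant_prob P pi /\
  exists C rho : R, (0 <= rho < 1)%R /\
  forall n : nat, (1 <= n)%N ->
    ereal_sup [set tv_dist (kiter P n y) pi | y in [set: T]]
      <= (C * rho ^+ n)%:E.

End uniform_ergodicity.

Section sdar.
Context (R : realType).
Implicit Types (f : R -> R) (alpha sigma y : R).

(* The value of the chain after y when the error is x, the persistence
   function at the given parameter being f. The error ranges over
   measurableTypeR R because this is where normal_prob lives; it is R with
   the same measurable sets (the Borel sets), under another display. *)
Definition sdar_next alpha f y (x : measurableTypeR R) : R :=
  alpha + f y * y + x.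

Lemma measurable_sdar_next2 alpha f : measurable_fun [set: R] f ->
  measurable_fun [set: R * measurableTypeR R]
    (fun z => sdar_next alpha f z.1 z.2).
Proof.
move=> mf; apply: measurable_funD => //.
apply: measurable_funD => //.
by apply: measurable_funM => //; apply: measurableT_comp.
Qed.

Let measurable_sdar_next alpha f y :
  measurable_fun [set: measurableTypeR R] (sdar_next alpha f y).
Proof. exact: measurable_funD. Qed.

HB.instance Definition _ alpha f y :=
  isMeasurableFun.Build _ _ _ _ (sdar_next alpha f y)
    (measurable_sdar_next alpha f y).

(* The measurability argument only serves to make this a kernel. *)
Definition sdar_kernel alpha sigma f (mf : measurable_fun [set: R] f) (y : R) :
    {measure set R -> \bar R} :=
  distribution (normal_prob 0 sigma) (sdar_next alpha f y).

Section sdar_kernel_is_pker.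
Variables (alpha sigma : R) (f : R -> R) (mf : measurable_fun [set: R] f).

Let measurable_sdar_kernel U : measurable U ->
  measurable_fun [set: R] (sdar_kernel alpha sigma mf ^~ U).
Proof.
move=> mU.
pose V := [set z : R * measurableTypeR R | U (sdar_next alpha f z.1 z.2)].
have mV : measurable V.
  rewrite -[V]setTI; exact: measurable_sdar_next2.
have := measurable_fun_xsection (normal_prob 0 sigma) mV.
apply: eq_measurable_fun => y _ /=.
by rewrite /sdar_kernel /distribution /pushforward /= xsectionE.
Qed.

HB.instance Definition _ := isKernel.Build _ _ _ _ _
  (sdar_kernel alpha sigma mf) measurable_sdar_kernel.

Let sdar_kernel_prob y : sdar_kernel alpha sigma mf y [set: R] = 1%E.
Proof. exact: (probability_setT (normal_prob 0 sigma)). Qed.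

HB.instance Definition _ := Kernel_isProbability.Build _ _ _ _ _
  (sdar_kernel alpha sigma mf) sdar_kernel_prob.

End sdar_kernel_is_pker.


Let measurable_translate (a : R) :
  measurable_fun [set: measurableTypeR R]
    ((fun x => a + x) : measurableTypeR R -> measurableTypeR R).
Proof. exact: measurable_funD. Qed.

Let lebesgue_translate (a : R) :
    {measure set (measurableTypeR R) -> \bar R} :=
  measure_function_pushforward__canonical__measure_function_Measure
    lebesgue_measure (measurable_translate a).

Let lebesgue_translateE (a : R) (A : set (measurableTypeR R)) :
  measurable A -> lebesgue_measure A = lebesgue_translate a A.
Proof.
apply: lebesgue_measure_unique => _ [[b c] _ <-] /=.
rewrite /lebesgue_translate /= /pushforward.
rewrite (_ : _ @^-1` _ = `](b - a), (c - a)]%classic).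
  rewrite !lebesgue_measure_itv/= !lte_fin ltrD2r.
  by case: ifP => // _; rewrite -!EFinB opprB addrA subrK.
apply/seteqP; split => x /=; rewrite !in_itv/= => /andP[bx xc].
  by rewrite ltrBlDl bx lerBrDl.
by rewrite -ltrBlDl bx -lerBrDl.
Qed.

Lemma sdar_kernelE alpha sigma f (mf : measurable_fun [set: R] f) y A :
  sigma != 0 -> measurable A ->
  sdar_kernel alpha sigma mf y A = normal_prob (alpha + f y * y) sigma A.
Proof.
move=> s0 mA; rewrite /sdar_kernel /distribution /pushforward /normal_prob.
set m := alpha + f y * y.
rewrite (eq_measure_integral (lebesgue_translate m)); last first.
  by move=> B mB _; exact: lebesgue_translateE.
rewrite [RHS](ge0_integral_pushforward (measurable_translate m))//.
- apply: eq_integral => x _ /=; congr EFin.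
  by rewrite !normal_pdfE// /normal_fun subr0 addrAC subrr add0r.
- apply/measurable_funTS/measurable_EFinP; exact: measurable_normal_pdf.
- by move=> x _; rewrite lee_fin normal_pdf_ge0.
Qed.

End sdar.

Arguments sdar_kernel {R} alpha sigma {f} mf y.

(* Main.v *)
(** The one-step kernel is a normal law whose mean stays in a bounded interval,
hence dominates a fixed multiple [e] of a fixed normal law [phi], uniformly in
the starting point (Doeblin's condition).  Writing [P = e phi + Q] with [Q] a
kernel of mass [1 - e], the measure [e * \sum_n phi Q^n] is invariant, and [P]
shrinks the oscillation of every bounded function by the factor [1 - e], so
that [P^n(y, A)] and [pi(A)], which is an average of the [P^n(z, A)], differ by
at most [(1 - e)^n]. *)

Require Import Defs.
From HB Require Import structures.
From mathcomp Require Import all_boot all_order all_algebra.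
From mathcomp Require Import all_classical all_reals all_analysis.
From mathcomp Require Import measurable_realfun ring lra.

Set Implicit Arguments.
Unset Strict Implicit.
Unset Printing Implicit Defensive.

Import Order.TTheory GRing.Theory Num.Theory.
Import numFieldNormedType.Exports.

Local Open Scope classical_set_scope.
Local Open Scope ring_scope.

(** * Integration against composed and iterated kernels *)

Section integral_kernel_composition.
Context d (T : measurableType d) (R : realType).
Local Open Scope ereal_scope.

(** Asking only that [nu] agree with the composite on measurable sets makes this serve both the
    iterates and, with a constant kernel as [l], an invariant law. *)
Lemma integral_spker_comp (l : R.-sfker T ~> T) (k : R.-spker T ~> T)
    (nu : {measure set T -> \bar R}) (x : T) (g : T -> \bar R) :
  (forall A, measurable A -> nu A = \int[l x]_y k y A) ->
  (forall y, 0 <= g y) -> measurable_fun [set: T] g ->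
  \int[nu]_y g y = \int[l x]_y \int[k y]_z g z.
Proof.
move=> nuE g0 mg.
rewrite -(@integral_kcomp _ _ _ _ _ _ _ l (kernel.kernel_snd k) x g)//.
by apply: eq_measure_integral => A mA _; rewrite nuE.
Qed.

Lemma integral_kiterS (P : R.-pker T ~> T) n x (g : T -> \bar R) :
  (forall y, 0 <= g y) -> measurable_fun [set: T] g ->
  \int[kiter P n.+1 x]_y g y = \int[kiter P n x]_y \int[P y]_z g z.
Proof. by move=> g0 mg; exact: integral_spker_comp. Qed.

Lemma integral_kiter_invariant (P : R.-pker T ~> T) (pi : probability T R) :
  invariant_prob P pi -> forall n (g : T -> \bar R),
  (forall y, 0 <= g y) -> measurable_fun [set: T] g ->
  \int[pi]_x \int[kiter P n x]_y g y = \int[pi]_y g y.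
Proof.
move=> piP; elim=> [|n IH] g g0 mg.
  by apply: eq_integral => x _; rewrite integral_dirac// diracT mul1e.
under eq_integral do rewrite integral_kiterS//.
rewrite IH.
(* Seen as a kernel that ignores its starting point, [pi] turns invariance into a composition
   identity; [point] is an arbitrary start. *)
- have mc : measurable_fun [set: T] (fun=> pi : pprobability T R).
    exact: measurable_cst.
  rewrite [RHS](@integral_spker_comp (kprobability mc) P pi point)//.
  by move=> A mA; exact/esym/piP.
- by move=> y; exact: integral_ge0.
- by apply: measurable_fun_integral_kernel => // U mU; exact: measurable_kernel.
Qed.

End integral_kernel_composition.

(** A nonnegative lower bound gives access to the monotonicity of integrals of nonnegative
    functions. *)
Lemma integral_between d (T : measurableType d) (R : realType)
    (mu : {measure set T -> \bar R}) (m a b : R) (g : T -> \bar R) :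
  mu [set: T] = m%:E -> (0 <= a)%R -> measurable_fun [set: T] g ->
  (forall x, a%:E <= g x <= b%:E)%E ->
  ((m * a)%:E <= \int[mu]_x g x <= (m * b)%:E)%E.
Proof.
move=> mum a0 mg gab.
have ga x : (a%:E <= g x)%E by case/andP: (gab x).
have gb x : (g x <= b%:E)%E by case/andP: (gab x).
have g0 x : (0 <= g x)%E by rewrite (le_trans _ (ga x))// lee_fin.
have cstE c : ((m * c)%:E = \int[mu]_x (cst c%:E) x)%E.
  by rewrite integral_cst// mum -EFinM mulrC.
by rewrite !cstE; apply/andP; split; apply: ge0_le_integral.
Qed.

(** * Splitting of the kernel, invariant law and contraction *)

Section residual.
Context d (T : measurableType d) (R : realType).
Variables (P : R.-pker T ~> T) (phi : probability T R) (e : R).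
Local Open Scope ereal_scope.

(* The truncation at 0 only matters for non-measurable sets; the proof argument
   only serves to make this a measure. *)
Definition residual (_ : forall y A, measurable A -> e%:E * phi A <= P y A)
  (y : T) (A : set T) : \bar R := maxe 0 (P y A - e%:E * phi A).

Hypothesis e0 : (0 < e)%R.
Hypothesis Pphi : forall y A, measurable A -> e%:E * phi A <= P y A.

Lemma residualE y A : measurable A -> residual Pphi y A = P y A - e%:E * phi A.
Proof.
move=> mA; apply/max_idPr; rewrite sube_ge0 ?Pphi//.
by rewrite fin_numM// fin_num_measure.
Qed.

Let residual0 y : residual Pphi y set0 = 0.
Proof. by rewrite residualE// !measure0 mule0 sube0. Qed.

Let residual_ge0 y A : 0 <= residual Pphi y A.
Proof. by rewrite le_max lexx. Qed.

Let residual_semi_sigma_additive y : semi_sigma_additive (residual Pphi y).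
Proof.
move=> F mF tF mUF; rewrite residualE//.
under eq_fun do under eq_bigr do rewrite residualE//.
have finP A : measurable A -> P y A \is a fin_num.
  exact: finite_kernel_measure.
have fphi i : phi (F i) \is a fin_num by exact: fin_num_measure.
have sphi n : \sum_(0 <= i < n) phi (F i) \is a fin_num.
  elim: n => [|n IH]; first by rewrite big_geq.
  by rewrite big_nat_recr//= fin_numD IH fphi.
(* Both measures are finite, so partial sums of differences split into differences of partial sums,
   which converge separately. *)
rewrite (_ : (fun n => \sum_(0 <= i < n) _) = (fun n =>
    \sum_(0 <= i < n) P y (F i) - e%:E * \sum_(0 <= i < n) phi (F i))).
  apply: cvgeB.
  - apply: fin_num_adde_defr. exact: finP.
  - exact: measure_semi_sigma_additive.
  - by apply: cvgeZl => //; exact: measure_semi_sigma_additive.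
apply/funext => n; elim: n => [|n IH].
  by rewrite !big_geq// mule0 sube0.
rewrite !big_nat_recr//= IH muleDr ?fin_num_adde_defr//.
by rewrite fin_num_oppeD ?fin_numM// addeACA.
Qed.

Let measurable_residual A : measurable A ->
  measurable_fun [set: T] (residual Pphi ^~ A).
Proof.
move=> mA; under eq_fun do rewrite residualE//.
by apply: emeasurable_funB => //; exact: measurable_kernel.
Qed.

HB.instance Definition _ y := isMeasure.Build _ _ _ (residual Pphi y)
  (residual0 y) (residual_ge0 y) (@residual_semi_sigma_additive y).

Definition kresidual : T -> {measure set T -> \bar R} := residual Pphi.

HB.instance Definition _ :=
  isKernel.Build _ _ _ _ _ kresidual measurable_residual.

Lemma kresidual_setT y : kresidual y [set: T] = (1 - e)%:E.
Proof.
by rewrite /kresidual/= residualE// prob_kernel probability_setT mule1.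
Qed.

Lemma kresidualD y A : measurable A ->
  P y A = e%:E * phi A + kresidual y A.
Proof.
move=> mA; rewrite /kresidual/= residualE// addeC subeK//.
by rewrite fin_numM// fin_num_measure.
Qed.

Let sprob_kresidual : ereal_sup [set kresidual y [set: T] | y in [set: T]] <= 1.
Proof.
apply/sprob_kernelP => y.
by rewrite kresidual_setT lee_fin lerBlDr lerDl ltW.
Qed.

HB.instance Definition _ :=
  Kernel_isSubProbability.Build _ _ _ _ _ kresidual sprob_kresidual.

(** The measure $\phi Q^n$, with $Q$ the residual kernel, encoded as a kernel constant in its
    argument so that kernel composition applies. *)
Fixpoint residual_iter n : R.-spker T ~> T :=
  if n is m.+1 then mkcomp_noparam (residual_iter m) kresidual
  else kprobability (measurable_cst (phi : pprobability T R)).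

Lemma residual_iter_setT n x : residual_iter n x [set: T] = ((1 - e) ^+ n)%:E.
Proof.
elim: n => [|n IH]; first exact: probability_setT.
rewrite [LHS](_ : _ = \int[residual_iter n x]_y (cst (1 - e)%:E) y).
  by rewrite integral_cst// IH -EFinM exprS.
by apply: eq_integral => y _; rewrite kresidual_setT.
Qed.

Lemma integral_residual y (g : T -> \bar R) :
  (forall x, 0 <= g x) -> measurable_fun [set: T] g ->
  \int[P y]_x g x = e%:E * \int[phi]_x g x + \int[kresidual y]_x g x.
Proof.
move=> g0 mg.
rewrite -(ge0_integral_mscale phi measurableT (NngNum (ltW e0)))//.
rewrite -ge0_integral_measure_add//.
by apply: eq_measure_integral => A mA _; rewrite [RHS]measure_addE kresidualD.
Qed.

(** If each step restarts from [phi] with probability [e], the term of index $n$ is the share of a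
    last restart $n$ steps ago. *)
Definition doeblin_measure : set T -> \bar R :=
  mscale (NngNum (ltW e0)) (mseries (residual_iter ^~ point) 0).

HB.instance Definition _ := Measure.on doeblin_measure.

Let onem_e_itv : (0 <= 1 - e < 1)%R.
Proof.
(* On the whole space the domination reads $e \le 1$. *)
have := Pphi point measurableT.
rewrite prob_kernel probability_setT mule1 lee_fin => e1.
by rewrite subr_ge0 e1 ltrBlDr ltrDl.
Qed.

Let series_residual_iter_setT :
  \sum_(n <oo) residual_iter n point [set: T] = e^-1%:E.
Proof.
apply/cvg_lim => //.
rewrite (_ : (fun n => _) = EFin \o series (geometric 1 (1 - e))); last first.
  apply/funext => n /=; rewrite /series/= -sumEFin.
  by apply: eq_bigr => i _; rewrite residual_iter_setT mul1r.
apply: cvg_EFin; first exact: nearW.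
(* The limit $e^{-1}$ is put in the form $1/(1-(1-e))$ of a geometric sum. *)
rewrite -[X in _ --> X]mul1r -[X in (1 / X)%R](subKr 1%R).
apply: cvg_geometric_series.
by case/andP: onem_e_itv => ? ?; rewrite ger0_norm.
Qed.

Let doeblin_measure_setT : doeblin_measure [set: T] = 1.
Proof.
rewrite [LHS](_ : _ = e%:E * \sum_(n <oo) residual_iter n point [set: T])//.
rewrite series_residual_iter_setT.
by rewrite -EFinM divff// gt_eqF.
Qed.

HB.instance Definition _ :=
  Measure_isProbability.Build _ _ _ doeblin_measure doeblin_measure_setT.

(** One step of [P] sends $\phi Q^n$ to $e(1-e)^n\phi + \phi Q^{n+1}$. The masses $(1-e)^n$ sum to
    $1/e$, so the first terms add up to $\phi$, which is the term of index 0 lost in the shift. *)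
Lemma doeblin_measure_invariant : invariant_prob P doeblin_measure.
Proof.
move=> A mA; have mP := measurable_kernel P A mA.
rewrite ge0_integral_mscale// ge0_integral_measure_series//.
transitivity (e%:E * \sum_(n <oo) residual_iter n point A); last by [].
congr (_ * _); rewrite [RHS]nneseries_recl//.
transitivity (\sum_(n <oo) (e%:E * phi A * residual_iter n point [set: T] +
  residual_iter n.+1 point A)).
  apply: eq_eseriesr => n _.
  rewrite [X in _ = _ + X](_ : _ =
    \int[residual_iter n point]_y kresidual y A)//.
  rewrite -integral_cst// -ge0_integralD//; first last.
  - exact: measurable_kernel.
  - by move=> y _; rewrite /= mule_ge0// lee_fin ltW.
  by apply: eq_integral => y _; rewrite kresidualD.
rewrite nneseriesD//; last first.
  by move=> n _ _; rewrite mule_ge0// mule_ge0// lee_fin ltW.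
rewrite -[X in _ = _ + X](nneseries_addn 1)//.
congr (_ + _); last by apply: eq_eseriesr => n _; rewrite addn1.
rewrite [RHS](_ : _ = phi A)//.
rewrite -(@fineK _ (phi A)) ?fin_num_measure// -EFinM nneseriesZl//.
rewrite series_residual_iter_setT -EFinM mulrAC divff ?mul1r ?gt_eqF//.
Qed.

(** The share $e\int g\,d\phi$ is common to all [y]; only the residual share, of mass $1-e$, varies.
    Keeping [a'] nonnegative allows iteration. *)
Lemma integral_contraction (g : T -> \bar R) (a b : R) :
  measurable_fun [set: T] g -> (0 <= a)%R -> (forall x, a%:E <= g x <= b%:E) ->
  exists a' b' : R, [/\ (0 <= a')%R, (b' - a' = (1 - e) * (b - a))%R &
    forall y, a'%:E <= \int[P y]_x g x <= b'%:E].
Proof.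
move=> mg a0 gab.
have g0 x : 0 <= g x.
  by have /andP[+ _] := gab x; apply: le_trans; rewrite lee_fin.
have rg y : ((1 - e) * a)%:E <= \int[kresidual y]_x g x <= ((1 - e) * b)%:E.
  exact: integral_between (kresidual_setT y) _ _ _.
have phig : \int[phi]_x g x \is a fin_num.
  have /andP[ag gb] := integral_between (probability_setT phi) a0 mg gab.
  by rewrite ge0_fin_numE ?integral_ge0// (le_lt_trans gb)// ltry.
set v := fine (\int[phi]_x g x).
exists (e * v + (1 - e) * a)%R, (e * v + (1 - e) * b)%R; split.
- rewrite addr_ge0// mulr_ge0//; first exact: ltW.
    by rewrite fine_ge0// integral_ge0.
  by case/andP: onem_e_itv.
- by ring.
- move=> y; rewrite integral_residual// -(fineK phig) -/v !EFinD -!EFinM.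
  by rewrite !leeD2lE.
Qed.

Lemma integral_kiter_contraction n (g : T -> \bar R) (a b : R) :
  measurable_fun [set: T] g -> (0 <= a)%R -> (forall x, a%:E <= g x <= b%:E) ->
  exists a' b' : R, [/\ (0 <= a')%R, (b' - a' = (1 - e) ^+ n * (b - a))%R &
    forall y, a'%:E <= \int[kiter P n y]_x g x <= b'%:E].
Proof.
elim: n g a b => [|n IH] g a b mg a0 gab.
  exists a, b; split=> //; first by rewrite mul1r.
  by move=> y; rewrite integral_dirac// diracT mul1e.
have g0 x : 0 <= g x.
  by have /andP[+ _] := gab x; apply: le_trans; rewrite lee_fin.
have [a1 [b1 [a10 ba1 Pg]]] := integral_contraction mg a0 gab.
have mPg : measurable_fun [set: T] (fun y => \int[P y]_x g x).
  by apply: measurable_fun_integral_kernel => // U mU; exact: measurable_kernel.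
(* Since [kiter] adds its new step last, the induction hypothesis is applied to the one-step average
   of [g]. *)
have [a2 [b2 [a20 ba2 kPg]]] := IH _ _ _ mPg a10 Pg.
exists a2, b2; split=> //; first by rewrite ba2 ba1 exprSr mulrA.
by move=> y; rewrite integral_kiterS.
Qed.

Theorem doeblin_uniformly_ergodic : uniformly_ergodic P.
Proof.
exists doeblin_measure; split; first exact: doeblin_measure_invariant.
(* The constant 1 is the oscillation bound of an indicator. *)
exists 1%R, (1 - e)%R; split=> // n _.
apply: ge_ereal_sup => _ [y _ <-]; apply: ge_ereal_sup => _ [A mA <-].
have mI : measurable_fun [set: T] (EFin \o \1_A : T -> \bar R).
  by apply/measurable_EFinP; exact: measurable_indic.
have I01 x : (0 : R)%:E <= (EFin \o (\1_A : T -> R)) x <= (1 : R)%:E.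
  by rewrite /= !lee_fin indicE; case: (_ \in _); rewrite /= ?lexx ?ler01.
have I0 x : 0 <= (EFin \o (\1_A : T -> R)) x by case/andP: (I01 x).
have [a [b [a0 + Pab]]] := integral_kiter_contraction n mI (lexx _) I01.
rewrite subr0 mulr1 mul1r => ab.
(* Invariance makes $\pi(A)$ the $\pi$-average of $P^n(z,A)$, so it lies in the same interval
   $[a,b]$ as $P^n(y,A)$. *)
have := integral_kiter_invariant doeblin_measure_invariant n I0 mI.
have mkI : measurable_fun [set: T]
    (fun z => \int[kiter P n z]_x (EFin \o \1_A) x).
  by apply: measurable_fun_integral_kernel => // U mU; exact: measurable_kernel.
have := integral_between (probability_setT doeblin_measure) a0 mkI Pab.
move=> /[swap] ->; have := Pab y.
rewrite !integral_indic// !setIT !mul1r.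
have between_fin x : a%:E <= x <= b%:E -> exists2 r, x = r%:E & (a <= r <= b)%R.
  by case: x => [r ?| |]; [exists r | rewrite leye_eq andbF | rewrite leeNy_eq].
move=> /between_fin[r -> /andP[? ?]] /between_fin[r' -> /andP[? ?]].
by rewrite -EFinB /= lee_fin -ab ler_norml; apply/andP; split; lra.
Qed.

End residual.

(** * Minorization of normal laws with bounded mean *)

Section normal_minorization.
Context (R : realType).
Implicit Types m s t K x : R.

(** The ratio of peaks exchanges the normalizing constants; the exponential is the worst loss due to
    a mean of size at most [K]. *)
Definition normal_minorant s t K : R :=
  normal_peak s / normal_peak t * expR (- (K ^+ 2 / s ^+ 2)).

Lemma normal_minorant_gt0 s t K :
  s != 0 -> t != 0 -> 0 < normal_minorant s t K.
Proof.
move=> s0 t0; rewrite mulr_gt0 ?expR_gt0//.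
by rewrite divr_gt0//; exact: normal_peak_gt0.
Qed.

(* The variance t^2 = s^2 / 2 is what (x - m)^2 <= 2 (x^2 + m^2) calls for. *)
Lemma normal_pdf_minorization m s t K x : s != 0 -> t != 0 ->
  t ^+ 2 *+ 2 = s ^+ 2 -> `|m| <= K ->
  normal_minorant s t K * normal_pdf 0 t x <= normal_pdf m s x.
Proof.
move=> s0 t0 ts mK; rewrite !normal_pdfE// /normal_minorant.
have pt0 : normal_peak t != 0 by rewrite gt_eqF ?normal_peak_gt0.
rewrite [leLHS](_ : _ = normal_peak s *
    (expR (- (K ^+ 2 / s ^+ 2)) * normal_fun 0 t x)); last by field.
rewrite ler_wpM2l ?normal_peak_ge0// /normal_fun ts subr0 -expRD ler_expR.
have s2 : 0 < s ^+ 2 by rewrite exprn_even_gt0.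
have mK2 : m ^+ 2 <= K ^+ 2.
  by rewrite -real_normK ?num_real// lerXn2r ?nnegrE ?(le_trans _ mK).
rewrite -subr_ge0.
rewrite [leRHS](_ : _ =
  (2 * K ^+ 2 + 2 * x ^+ 2 - (x - m) ^+ 2) / (2 * s ^+ 2)); last by field.
apply: divr_ge0; last by rewrite mulr_ge0// ltW.
(* The numerator equals $2(K^2-m^2)+(x+m)^2$. *)
have : 0 <= (x + m) ^+ 2 by exact: sqr_ge0.
nra.
Qed.

Lemma normal_prob_minorization m s t K A : s != 0 -> t != 0 ->
  t ^+ 2 *+ 2 = s ^+ 2 -> `|m| <= K -> measurable A ->
  ((normal_minorant s t K)%:E * normal_prob 0 t A <= normal_prob m s A)%E.
Proof.
move=> s0 t0 ts mK mA; rewrite /normal_prob -ge0_integralZl//.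
- apply: ge0_le_integral => //.
  + move=> x _; rewrite mule_ge0// lee_fin ?normal_pdf_ge0//.
    by rewrite ltW ?normal_minorant_gt0.
  + apply/measurable_funTS/measurable_funeM/measurable_EFinP.
    exact: measurable_normal_pdf.
  + apply/measurable_funTS/measurable_EFinP; exact: measurable_normal_pdf.
  + by move=> x _; rewrite -EFinM lee_fin normal_pdf_minorization.
- apply/measurable_funTS/measurable_EFinP; exact: measurable_normal_pdf.
- by move=> x _; rewrite lee_fin normal_pdf_ge0.
- by rewrite lee_fin ltW ?normal_minorant_gt0.
Qed.

End normal_minorization.

(** All one-step means lie within $|\alpha|+M$ of 0, so one minorant serves every starting point. *)
Theorem proposition2 (R : realType) (p : nat)
    (A : set R) (G : set 'rV[R]_p) (S : set R)
    (hS : S `<=` [set s | 0 < s])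
    (psi : R -> 'rV[R]_p -> R)
    (alpha : R) (gamma : 'rV[R]_p) (sigma : R)
    (htheta : (A `*` G `*` S) (alpha, gamma, sigma))
    (mpsi : measurable_fun [set: R] (psi ^~ gamma))
    (hbound : exists M : R, forall y : R, `|psi y gamma * y| <= M) :
  uniformly_ergodic (sdar_kernel alpha sigma mpsi).
Proof.
have s0 : sigma != 0 by case: htheta => _ /hS /=; exact: lt0r_neq0.
have [M bM] := hbound.
pose t := sigma / Num.sqrt 2.
have t0 : t != 0 by rewrite mulf_neq0// invr_neq0// gt_eqF// sqrtr_gt0.
have ts : t ^+ 2 *+ 2 = sigma ^+ 2.
  by rewrite exprMn exprVn sqr_sqrtr// -mulr_natr divfK.
(* The pushforward is along $x \mapsto 0+0\cdot 0+x$, the identity; it only carries the normal law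
   from [measurableTypeR R] to [R]. *)
pose phi : probability R R :=
  distribution (normal_prob 0 t) (sdar_next 0 (cst 0) 0).
apply: (@doeblin_uniformly_ergodic _ _ _ _ phi _
  (normal_minorant_gt0 (`|alpha| + M) s0 t0)) => y B mB.
have phiB : phi B = normal_prob 0 t B.
  (* [phi] is also an SDAR kernel with zero persistence, so [sdar_kernelE] evaluates it. *)
  have m0 : measurable_fun [set: R] (cst 0 : R -> R) by exact: measurable_cst.
  rewrite -[LHS]/(sdar_kernel 0 t m0 0 B) sdar_kernelE//.
  by rewrite /= mul0r addr0.
rewrite [X in (_ * X <= _)%E]phiB sdar_kernelE//.
apply: normal_prob_minorization => //.
by rewrite (le_trans (ler_normD _ _))// lerD2l.
Qed.
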